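(* Let $r\leq s\leq n-1$ be positive integers. Then $$\mathsf{ehr}_{\Delta_{r-1,s}\times\Delta_{1,n-s}}(t)\preceq \mathsf{ehr}_{\mathsf{Pan}_{r,s,n}}(t).$$
   Context: For a lattice polytope $P\subset\mathbb{R}^d$, its Ehrhart polynomial $\mathsf{ehr}_P(t)$ is the polynomial in $t$ that agrees with $|tP\cap\mathbb{Z}^d|$ for all integers $t\ge 0$. For a matroid $M$ on $[n]=\{1,\dots,n\}$, $\mathsf{ehr}_M(t)$ denotes the Ehrhart polynomial of its base polytope $\mathcal{P}_M\subset\mathbb{R}^n$, the convex hull of the indicator vectors of the bases of $M$. The hypersimplex $\Delta_{a,b}$ is the base polytope of the uniform matroid $U_{a,b}$, i.e. the convex hull in $\mathbb{R}^b$ of all $0/1$ vectors with exactly $a$ ones (so $\Delta_{1,b}$ is a simplex). For $1\le r\le s<n$, the panhandle matroid $\mathsf{Pan}_{r,s,n}$ is the matroid of rank $r$ on $[n]$ whose bases are the sets $B\in\binom{[n]}{r}$ with $|B\cap[s]|\geq r-1$. For polynomials $p(t),q(t)$, $p(t)\preceq q(t)$ means that for every $d\ge 0$ the coefficient of $t^d$ in $p$ is at most the coefficient of $t^d$ in $q$. *)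

(* Defs.v *)
From HB Require Import structures.
From mathcomp Require Import all_boot all_order all_algebra.
From mathcomp Require Import boolp classical_sets functions cardinality reals.
From mathcomp Require Import convex.
Set Implicit Arguments.
Unset Strict Implicit.
Unset Printing Implicit Defensive.
Import Order.TTheory GRing.Theory Num.Theory.
Local Open Scope classical_set_scope.
Local Open Scope ring_scope.
Local Open Scope card_scope.

Definition conv_hull (R : realType) (d : nat) (V : set 'rV[R]_d) :
    set 'rV[R]_d :=
  smallest (fun A : set 'rV[R]_d => convex_set A) V.

Definition dilate (R : realType) (d : nat) (t : nat) (P : set 'rV[R]_d) :
    set 'rV[R]_d :=
  [set t%:R *: x | x in P].

Definition lattice_points (R : realType) (d : nat) (P : set 'rV[R]_d) :
    set 'rV[int]_d :=
  [set z | P (map_mx intr z)].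

Definition prod_polytope (R : realType) (d e : nat)
    (P : set 'rV[R]_d) (Q : set 'rV[R]_e) : set 'rV[R]_(d + e) :=
  [set row_mx x y | x in P & y in Q].

Definition is_ehrhart (R : realType) (d : nat) (P : set 'rV[R]_d)
    (p : {poly rat}) : Prop :=
  forall t : nat, exists2 k : nat,
    lattice_points (dilate t P) #= `I_k & p.[t%:R] = k%:R.

(* Unspecified (here 0) when no polynomial counts the lattice points of the
   dilates of P; Ehrhart's theorem rules this out for lattice polytopes. *)
Definition ehrhart (R : realType) (d : nat) (P : set 'rV[R]_d) : {poly rat} :=
  xget 0 [set p | is_ehrhart P p].

Lemma is_ehrhart_inj (R : realType) (d : nat) (P : set 'rV[R]_d)
    (p q : {poly rat}) : is_ehrhart P p -> is_ehrhart P q -> p = q.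
Proof.
move=> hp hq; apply/eqP; rewrite -subr_eq0; apply/negP => /negP nz.
have root_nat (t : nat) : root (p - q) t%:R.
  have [k hk pk] := hp t; have [l hl ql] := hq t.
  have : `I_k #= `I_l by apply: card_eq_trans hl; rewrite card_eq_sym.
  by move/card_eq_II => kl; rewrite /root hornerD hornerN pk ql kl subrr.
pose s : seq rat := [seq i%:R | i <- iota 0 (size (p - q)%R)].
have us : uniq s.
  by rewrite map_inj_uniq ?iota_uniq// => i j /eqP; rewrite eqr_nat => /eqP.
have rs : all (root (p - q)) s by apply/allP => _ /mapP[i _ ->].
by have := max_poly_roots nz rs us; rewrite size_map size_iota ltnn.
Qed.

Lemma ehrhart_unique (R : realType) (d : nat) (P : set 'rV[R]_d)
    (p : {poly rat}) : is_ehrhart P p -> ehrhart P = p.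
Proof.
move=> hp; apply: (is_ehrhart_inj _ hp).
exact: (@xgetI _ 0 [set q | is_ehrhart P q] p hp).
Qed.

Definition coef_le (p q : {poly rat}) : Prop := forall d : nat, p`_d <= q`_d.

Record matroid (E : finType) := Matroid {
  bases : {set {set E}};
  bases_neq0 : bases != finset.set0;
  basis_exchange : forall A B : {set E}, A \in bases -> B \in bases ->
    forall a, a \in A :\: B ->
    exists2 b, b \in B :\: A & (b |: (A :\ a))%SET \in bases
}.

Definition indicator_vec (R : realType) (n : nat) (B : {set 'I_n}) : 'rV[R]_n :=
  \row_i (i \in B)%:R.

Definition base_polytope (R : realType) (n : nat) (M : matroid 'I_n) :
    set 'rV[R]_n :=
  conv_hull [set indicator_vec R B | B in [set B | B \in bases M]].
Arguments base_polytope R {n} M _.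

Definition ehr_matroid (R : realType) (n : nat) (M : matroid 'I_n) :
    {poly rat} :=
  ehrhart (base_polytope R M).

Definition uniform_bases (a b : nat) : {set {set 'I_b}} :=
  [set B : {set 'I_b} | #|B| == a]%SET.

Definition hypersimplex (R : realType) (a b : nat) : set 'rV[R]_b :=
  conv_hull
    [set indicator_vec R B | B in [set B : {set 'I_b} | B \in uniform_bases a b]].
Arguments hypersimplex R a b _ : clear implicits.

(* The ground set {1, ..., n} is 'I_n = {0, ..., n - 1}, so [s] becomes the set
   of the i : 'I_n with i < s. *)
Definition initial (s n : nat) : {set 'I_n} := [set i : 'I_n | (i < s)%N]%SET.

Definition panhandle_bases (r s n : nat) : {set {set 'I_n}} :=
  [set B : {set 'I_n} |
     (#|B| == r) && (r - 1 <= #|B :&: initial s n|)%N]%SET.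

Lemma card_exchange (E : finType) (A : {set E}) (a b : E) :
  a \in A -> b \notin A -> #|(b |: (A :\ a))%SET| = #|A|.
Proof.
move=> aA bA; rewrite cardsU1 in_setD1 (negbTE bA) andbF /=.
by rewrite [RHS](cardsD1 a) aA.
Qed.

Lemma setD_exchange_neq0 (E : finType) (A B : {set E}) (r : nat) (a : E) :
  #|A| = r -> #|B| = r -> a \in A :\: B -> exists b, b \in B :\: A.
Proof.
move=> cA cB aAB; apply/finset.set0Pn; rewrite -card_gt0.
have : (0 < #|A :\: B|)%N by rewrite card_gt0; apply/finset.set0Pn; exists a.
by rewrite !cardsD cA cB [B :&: A]finset.setIC.
Qed.

Lemma card_initial (s n : nat) : (s <= n)%N -> #|initial s n| = s.
Proof.
move=> le_sn; rewrite -[RHS]card_ord.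
have inj_w : injective (widen_ord le_sn) by move=> i j /(congr1 val) /= /val_inj.
rewrite -(card_imset 'I_s inj_w); congr #|pred_of_set _|.
apply/setP => i; rewrite inE; apply/idP/imsetP => [lt_is|[j _ ->]]; last first.
  exact: (ltn_ord j).
by exists (Ordinal lt_is) => //; apply: val_inj.
Qed.

Lemma uniform_bases_neq0 (a b : nat) :
  (a <= b)%N -> uniform_bases a b != finset.set0.
Proof.
move=> le_ab; apply/finset.set0Pn; exists (initial a b).
by rewrite inE card_initial.
Qed.

Lemma uniform_exchange (a b : nat) (A B : {set 'I_b}) :
  A \in uniform_bases a b -> B \in uniform_bases a b ->
  forall x, x \in A :\: B ->
  exists2 y, y \in B :\: A & (y |: (A :\ x))%SET \in uniform_bases a b.
Proof.
rewrite !inE => /eqP cA /eqP cB x xAB.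
have [y yBA] := setD_exchange_neq0 cA cB xAB; exists y => //.
move: xAB yBA; rewrite !inE => /andP[_ xA] /andP[yA _].
by rewrite card_exchange// cA.
Qed.

Definition uniform_matroid (a b : nat) (le_ab : (a <= b)%N) : matroid 'I_b :=
  Matroid (uniform_bases_neq0 le_ab) (@uniform_exchange a b).

Lemma hypersimplexE (R : realType) (a b : nat) (le_ab : (a <= b)%N) :
  hypersimplex R a b = base_polytope R (uniform_matroid le_ab).
Proof. by []. Qed.

Lemma panhandle_bases_neq0 (r s n : nat) :
  (r <= s)%N -> (s < n)%N -> panhandle_bases r s n != finset.set0.
Proof.
move=> le_rs lt_sn; have le_rn := leq_trans le_rs (ltnW lt_sn).
apply/finset.set0Pn; exists (initial r n).
rewrite inE card_initial// eqxx/= (_ : _ :&: _ = initial r n).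
  by rewrite card_initial// leq_subr.
apply/setP => i; rewrite !inE; apply: andb_idr => lt_ir.
exact: leq_trans lt_ir le_rs.
Qed.

Lemma panhandle_exchange (r s n : nat) (A B : {set 'I_n}) :
  A \in panhandle_bases r s n -> B \in panhandle_bases r s n ->
  forall x, x \in A :\: B ->
  exists2 y, y \in B :\: A & (y |: (A :\ x))%SET \in panhandle_bases r s n.
Proof.
rewrite !inE => /andP[/eqP cA hA] /andP[/eqP cB hB] x xAB.
have [y0 y0BA] := setD_exchange_neq0 cA cB xAB.
have /andP[xB xA] : (x \notin B) && (x \in A) by move: xAB; rewrite inE.
have rgt0 : (0 < r)%N by rewrite -cA card_gt0; apply/finset.set0Pn; exists x.
have exch y : y \in B :\: A ->
    (r - 1 <= #|(y |: (A :\ x)) :&: initial s n|)%N ->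
    exists2 y, y \in B :\: A & (y |: (A :\ x))%SET \in panhandle_bases r s n.
  move=> yBA h; exists y => //; rewrite inE h andbT.
  by move: yBA; rewrite inE => /andP[yA _]; rewrite card_exchange// cA.
have sub y : (A :\ x) :&: initial s n \subset (y |: (A :\ x)) :&: initial s n.
  by apply: finset.setSI; apply: finset.subsetUr.
have cAx : #|A :\ x| = (r - 1)%N by have := cardsD1 x A; rewrite xA cA => ->; rewrite add1n subn1.
have [xs|xs] := boolP (x \in initial s n); last first.
  apply: (exch y0) => //; apply: leq_trans hA _.
  apply: leq_trans (subset_leq_card (sub y0)); apply: subset_leq_card.
  apply/fintype.subsetP => i; rewrite !finset.in_setI in_setD1 => /andP[-> is_].
  by rewrite is_ !andbT; apply: contraNneq xs => <-.
have cI : #|A :&: initial s n| = #|((A :\ x) :&: initial s n)|.+1.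
  rewrite (cardsD1 x) finset.in_setI xA xs; congr _.+1; apply: eq_card => i.
  by rewrite !inE andbA.
have [y1 /andP[y1BA y1s]|no] := pickP [pred y | (y \in B :\: A) && (y \in initial s n)].
  apply: (exch y1) => //; apply: leq_trans hA _; rewrite cI.
  have y1A : y1 \notin A by move: y1BA; rewrite inE => /andP[].
  have -> : ((y1 |: (A :\ x)) :&: initial s n = y1 |: ((A :\ x) :&: initial s n))%SET.
    by apply/setP => i; rewrite !inE; have [->|] := eqVneq i y1; move: y1s; rewrite ?inE.
  by rewrite cardsU1 finset.in_setI in_setD1 (negbTE y1A) andbF.
have out (S : {set 'I_n}) : #|S| = r -> (r - 1 <= #|S :&: initial s n|)%N ->
    (#|S :\: initial s n| <= 1)%N.
  by move=> cS hS; rewrite cardsD cS leq_subLR addnC -leq_subLR.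
have y0A : y0 \notin A by move: y0BA; rewrite inE => /andP[].
have y0B : y0 \in B by move: y0BA; rewrite inE => /andP[].
have y0s : y0 \notin initial s n by have := no y0; rewrite /= y0BA => /negbT.
have AxS : A :\ x \subset initial s n.
  apply/fintype.subsetP => z; rewrite in_setD1 => /andP[zx zA]; apply/negPn/negP => zs.
  have zNB : z \notin B.
    apply/negP => zB; have /card_le1P/(_ y0) := out B cB hB.
    rewrite finset.in_setD y0s y0B => /(_ isT) /(_ z); rewrite inE zs zB => /esym/eqP zy.
    by rewrite -zy zA in y0A.
  have : (#|A :\: B| <= 1)%N.
    have -> : #|A :\: B| = #|B :\: A|.
      by rewrite !cardsD cA cB [B :&: A]finset.setIC.
    apply: leq_trans (out B cB hB); apply: subset_leq_card.
    apply/fintype.subsetP => i iBA; rewrite finset.in_setD.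
    have := no i; rewrite /= iBA /= => ->.
    by move: iBA; rewrite inE => /andP[].
  move=> /card_le1P/(_ x xAB)/(_ z); rewrite inE zNB zA inE => /esym.
  by rewrite (negbTE zx).
apply: (exch y0) => //; apply: leq_trans (subset_leq_card (sub y0)).
by rewrite (finset.setIidPl AxS) cAx.
Qed.

Definition panhandle (r s n : nat) (le_rs : (r <= s)%N) (lt_sn : (s < n)%N) :
    matroid 'I_n :=
  Matroid (panhandle_bases_neq0 le_rs lt_sn) (@panhandle_exchange r s n).

(* Main.v *)
(** Write m = n - s, and let g(N) be the number of y in {0, ..., t}^s with sum N.
    The panhandle polytope dilated by t has
    \sum_(0 <= j <= t) 'C(j + m - 1, m - 1) g(rt - j) lattice points, and the
    summand j = t counts those of the product. So one must see that
      \sum_(j < t) 'C(j + m - 1, m - 1) g((r - 1)t + (t - j))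
    is a polynomial in t with nonnegative coefficients. For 1 <= w <= t,
      \sum_k x^k g(kt + w) = [z^(s-1)] (1-z)^-(w+1) (1-xz)^-(t-w+1) K(z), where
      K(z) = 1 / (1 - \sum_(i >= 2) 'C(t+i-1, i) (x + x^2 + ... + x^(i-1)) z^i),
    and K has nonnegative coefficients in t, x and z. It remains to prove the
    same for the sums \sum_(j < t) 'C(j+b, b) 'C(j+c, c) 'C(t-j+a, a). They are
    sums of a rising factorial of t times a Beta integral
      \int x^b (1-x)^a h_c(x) dx, h_c(x) = \sum_l 'C(c, l) 'C(t-1, l) x^l,
    and with e_(c+1)(x) = \sum_l 'C(c, l) 'C(t, l+1) x^(l+1) one has the
    subtraction-free recursion
      (c+1) e_(c+1) = t x h_c + c e_c and h_(c+1) = (1-x) h_c + e_(c+1). *)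

Require Import Defs.
From mathcomp Require Import all_boot all_order all_algebra.
From mathcomp Require Import boolp classical_sets reals.
From mathcomp Require Import cardinality interval_inference convex.
From mathcomp Require Import zify ring.
Set Implicit Arguments.
Unset Strict Implicit.
Unset Printing Implicit Defensive.
Import Order.TTheory GRing.Theory Num.Theory.
Local Open Scope ring_scope.

(** * Polynomials in t with nonnegative coefficients *)

(** Stated for functions of [t] rather than polynomials, so that sums whose range depends on [t]
    qualify. *)
Definition nneg_polyfun (f : nat -> rat) : Prop :=
  exists2 p : {poly rat}, (forall i, 0 <= p`_i) & forall t, f t = p.[t%:R].

Lemma eq_nneg_polyfun f g : f =1 g -> nneg_polyfun f -> nneg_polyfun g.
Proof. by move=> fg [p p0 fp]; exists p => // t; rewrite -fg. Qed.

Lemma nneg_polyfunD f g :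
  nneg_polyfun f -> nneg_polyfun g -> nneg_polyfun (fun t => f t + g t).
Proof.
move=> [p p0 fp] [q q0 gq]; exists (p + q) => [i|t].
  by rewrite coefD addr_ge0.
by rewrite hornerD fp gq.
Qed.

Lemma nneg_polyfunM f g :
  nneg_polyfun f -> nneg_polyfun g -> nneg_polyfun (fun t => f t * g t).
Proof.
move=> [p p0 fp] [q q0 gq]; exists (p * q) => [i|t].
  by rewrite coefM; apply: sumr_ge0 => j _; rewrite mulr_ge0.
by rewrite hornerM fp gq.
Qed.

Lemma nneg_polyfunC c : 0 <= c -> nneg_polyfun (fun=> c).
Proof.
move=> c0; exists c%:P => [i|t]; last by rewrite hornerC.
by rewrite coefC; case: ifP.
Qed.

Lemma nneg_polyfun_id : nneg_polyfun (fun t => t%:R).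
Proof. by exists 'X => [i|t]; rewrite ?coefX ?hornerX. Qed.

Lemma nneg_polyfun_sum (I : Type) (r : seq I) (P : pred I) (F : I -> nat -> rat) :
  (forall i, P i -> nneg_polyfun (F i)) ->
  nneg_polyfun (fun t => \sum_(i <- r | P i) F i t).
Proof.
move=> hF; elim: r => [|i r IH].
  by apply: eq_nneg_polyfun (nneg_polyfunC (lexx 0)) => t; rewrite big_nil.
have [Pi|nPi] := boolP (P i).
  apply: eq_nneg_polyfun (nneg_polyfunD (hF i Pi) IH) => t.
  by rewrite big_cons Pi.
by apply: eq_nneg_polyfun IH => t; rewrite big_cons (negbTE nPi).
Qed.

Lemma nneg_polyfun_bin i : nneg_polyfun (fun t => 'C(t + i, i)%:R).
Proof.
elim: i => [|i IH].
  by apply: eq_nneg_polyfun (nneg_polyfunC ler01) => t; rewrite bin0.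
have c0 : 0 <= (i.+1%:R : rat)^-1 by rewrite invr_ge0.
apply: eq_nneg_polyfun (nneg_polyfunM (nneg_polyfunM (nneg_polyfunC c0)
  (nneg_polyfunD nneg_polyfun_id (nneg_polyfunC (ler0n _ i.+1)))) IH) => t /=.
have ne : (i.+1%:R : rat) != 0 by rewrite pnatr_eq0.
apply: (mulfI ne); rewrite -!mulrA mulVKf// -natrD -!natrM; congr (_%:R).
by have := mul_bin_diag (t + i.+1) i; rewrite addnS.
Qed.

Lemma nneg_polyfun_binS i : nneg_polyfun (fun t => 'C(t + i, i.+1)%:R).
Proof.
have c0 : 0 <= (i.+1%:R : rat)^-1 by rewrite invr_ge0.
apply: eq_nneg_polyfun (nneg_polyfunM (nneg_polyfunM (nneg_polyfunC c0)
  nneg_polyfun_id) (nneg_polyfun_bin i)) => t /=.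
have ne : (i.+1%:R : rat) != 0 by rewrite pnatr_eq0.
apply: (mulfI ne); rewrite -!mulrA mulVKf// -!natrM; congr (_%:R).
by rewrite mul_bin_left addnK.
Qed.

(** * Beta integrals and sums of triple products of binomials *)

(** Compare coefficients of z^n in z^(p-b) (1-z)^-(p+1) times (1-z)^-(a+1); a negative shift p - b
    would cut off terms. *)
Lemma sum_bin_conv a b p n : (b <= p)%N ->
  (\sum_(i < n.+1) 'C(i + b, p) * 'C(n - i + a, a) = 'C(n + a + b + 1, p + a + 1))%N.
Proof.
move=> le_bp; elim: a n => [|a IHa] n.
  elim: n => [|n IHn].
    rewrite big_ord1 !bin0 muln1 !addn0 !add0n !addn1 binS.
    by rewrite [X in (_ = X + _)%N]bin_small.
  rewrite big_ord_recr /= bin0 muln1 !addn0 !addn1 binS; congr (_ + _)%N.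
  rewrite addSn -[(n + b).+1]addn1 -[p.+1]addn1.
  move: IHn; rewrite !addn0 => <-.
  by apply: eq_bigr => i _; rewrite !bin0.
elim: n => [|n IHn].
  rewrite big_ord1 subn0 !add0n binn muln1.
  have [lt_bp|le_pb] := ltnP b p; first by rewrite !bin_small//; lia.
  have -> : (a.+1 + b + 1 = p + a.+1 + 1)%N by lia.
  by rewrite binn (_ : b = p) ?binn//; lia.
have -> : (n.+1 + a.+1 + b + 1 = (n.+1 + a + b + 1).+1)%N by lia.
have -> : (p + a.+1 + 1 = (p + a + 1).+1)%N by lia.
rewrite binS -IHa.
have -> : (n.+1 + a + b + 1 = n + a.+1 + b + 1)%N by lia.
have -> : ((p + a + 1).+1 = p + a.+1 + 1)%N by lia.
rewrite -IHn big_ord_recr [X in (_ = _ + X)%N]big_ord_recr /= subnn !add0n !binn addnA.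
rewrite -big_split /=; congr (_ + _)%N; apply: eq_bigr => i _.
rewrite -mulnDr; congr (_ * _)%N.
have -> : (n.+1 - i + a.+1 = (n.+1 - i + a).+1)%N by lia.
by rewrite binS; congr ('C(_, _) + _)%N; have := ltn_ord i; lia.
Qed.

(* The integral of x^b (1 - x)^a over [0, 1]. *)
Definition beta_moment (b a : nat) : rat := (b`! * a`!)%:R / (a + b).+1`!%:R.

Lemma beta_moment_ge0 b a : 0 <= beta_moment b a.
Proof. by rewrite divr_ge0. Qed.

(** Insert 1 = (1 - x) + x under the integral. *)
Lemma beta_moment_split b a :
  beta_moment b a = beta_moment b a.+1 + beta_moment b.+1 a.
Proof.
have f0 k : (k`!%:R : rat) != 0 by rewrite pnatr_eq0 -lt0n fact_gt0.
have fS k : (k.+1`!%:R : rat) = (k%:R + 1) * k`!%:R by rewrite factS natrM -natr1.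
have nz : ((a + b)%:R + 1 + 1 : rat) != 0 by rewrite !natr1 pnatr_eq0.
have := f0 (a + b).+1; rewrite /beta_moment addSn addnS (fS (a + b).+1).
rewrite -[(a + b).+1%:R]natr1 (natrM _ b`! a`!) (natrM _ b`! a.+1`!).
rewrite (natrM _ b.+1`! a`!) (fS a) (fS b); move: ((a + b).+1`!%:R : rat) nz => F.
rewrite natrD => nz nF; by field; apply/andP.
Qed.

(* [betaX] and [betaY] are the integrals over [0, 1] of x^b (1 - x)^a times the
   coefficient of z^c in (1 - z)^(-1) (1 + xz / (1 - z))^(t - 1), respectively
   of z^(c + 1) in (1 + xz / (1 - z))^t. *)
Definition betaX a b c t : rat :=
  \sum_(l < c.+1) ('C(c, l) * 'C(t.-1, l))%:R * beta_moment (b + l) a.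
Definition betaY a b c t : rat :=
  \sum_(l < c.+1) ('C(c, l) * 'C(t, l.+1))%:R * beta_moment (b + l.+1) a.

(** Integrated form of h_(c+1) = (1-x) h_c + e_(c+1), from Pascal's rule in [c] on the left and in
    [t] on [betaY]. *)
Lemma betaX_recl a b c t :
  betaX a b c.+1 t.+1 = betaX a.+1 b c t.+1 + betaY a b c t.+1.
Proof.
rewrite /betaX /betaY /=.
have e1 : \sum_(l < c.+2) ('C(c.+1, l) * 'C(t, l))%:R * beta_moment (b + l) a =
  \sum_(l < c.+1) ('C(c, l) * 'C(t, l))%:R * beta_moment (b + l) a +
  \sum_(l < c.+1) ('C(c, l) * 'C(t, l.+1))%:R * beta_moment (b + l.+1) a.
  rewrite big_ord_recl [X in _ = X + _]big_ord_recl /= !bin0 -!addrA; congr (_ + _).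
  rewrite (eq_bigr (fun i : 'I_c.+1 => ('C(c, i.+1) * 'C(t, i.+1))%:R * beta_moment (b + i.+1) a
    + ('C(c, i) * 'C(t, i.+1))%:R * beta_moment (b + i.+1) a)); last first.
    by move=> i _; rewrite /bump leq0n add1n binS mulnDl natrD mulrDl.
  by rewrite big_split /= big_ord_recr /= (@bin_small c c.+1)// mul0n mul0r addr0.
rewrite e1 -!big_split /=; apply: eq_bigr => l _.
rewrite (beta_moment_split (b + l)) addnS !natrM binS natrD; ring.
Qed.

(** Split c + 1 = (l + 1) + (c - l) in each summand and absorb the first part into ['C(t, l.+1)],
    the second into ['C(c, l)]. *)
Lemma betaY_rec a b c t :
  c.+1%:R * betaY a b c t = t%:R * betaX a b.+1 c t + c%:R * betaY a b c.-1 t.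
Proof.
have -> : c%:R * betaY a b c.-1 t =
  \sum_(l < c.+1) ((c - l) * 'C(c, l) * 'C(t, l.+1))%:R * beta_moment (b + l.+1) a.
  case: c => [|c]; first by rewrite mul0r big_ord1 sub0n !mul0n mul0r.
  rewrite /= big_ord_recr /= subnn !mul0n mul0r addr0 /betaY mulr_sumr.
  apply: eq_bigr => l _.
  by rewrite -[in RHS]mul_bin_down mulrA -natrM mulnA.
rewrite /betaX /betaY !mulr_sumr -big_split /=; apply: eq_bigr => l _.
rewrite addSnnS; move: (beta_moment _ _) => B.
rewrite !mulrA -mulrDl; congr (_ * _).
rewrite -!natrM -natrD; congr (_%:R).
rewrite [X in _ = (X + _)%N]mulnCA mul_bin_diag.
have -> : (c.+1 * ('C(c, l) * 'C(t, l.+1)) =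
  (l.+1 + (c - l)) * ('C(c, l) * 'C(t, l.+1)))%N.
  by congr (_ * _)%N; have := ltn_ord l; lia.
by rewrite mulnDl; ring.
Qed.

(** The recursions are coupled, so both claims go through one induction. [betaX] is matched only at
    positive arguments because [t.-1] truncates at 0; the factor [t] in [betaY_rec] hides that
    value. *)
Lemma nneg_betaXY c a b :
  (exists2 f, nneg_polyfun f & forall t, f t.+1 = betaX a b c t.+1) /\
  nneg_polyfun (betaY a b c).
Proof.
elim: c a b => [|c IHc].
  move=> a b; split.
    exists (fun=> beta_moment b a); first exact/nneg_polyfunC/beta_moment_ge0.
    by move=> t; rewrite /betaX big_ord1 !bin0 addn0 mul1r.
  apply: eq_nneg_polyfun (nneg_polyfunM nneg_polyfun_id
    (nneg_polyfunC (beta_moment_ge0 b.+1 a))) => t.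
  by rewrite /betaY big_ord1 bin0 mul1n bin1 addn1.
have HX a b : exists2 f, nneg_polyfun f & forall t, f t.+1 = betaX a b c.+1 t.+1.
  have [[f f0 fE] _] := IHc a.+1 b; have [_ Y0] := IHc a b.
  exists (fun t => f t + betaY a b c t); first exact: nneg_polyfunD.
  by move=> t; rewrite betaX_recl fE.
move=> a b; split => //.
have [f f0 fE] := HX a b.+1; have [_ Y0] := IHc a b.
have c0 : 0 <= (c.+2%:R : rat)^-1 by rewrite invr_ge0.
apply: eq_nneg_polyfun (nneg_polyfunM (nneg_polyfunC c0)
  (nneg_polyfunD (nneg_polyfunM nneg_polyfun_id f0)
     (nneg_polyfunM (nneg_polyfunC (ler0n _ c.+1)) Y0))) => t /=.
have ne : (c.+2%:R : rat) != 0 by rewrite pnatr_eq0.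
apply: (mulfI ne); rewrite mulVKf// [RHS]betaY_rec /=; congr (_ + _).
by case: t => [|t]; rewrite ?mul0r// fE.
Qed.

(* Conditionally on x, drawn from the Beta distribution with parameters b + 1
   and a + 1, let j be binomial with parameters t and x: the sum is, up to
   normalization, the expectation of 'C(j + c, c). *)
Lemma sum_bin3E a b c t :
  (\sum_(j < t.+1) 'C(j + b, b) * 'C(j + c, c) * 'C(t - j + a, a))%:R =
  'C(t.+1 + (a + b), (a + b).+1)%:R / beta_moment b a * betaX a b c t.+1.
Proof.
have vdm j : ('C(j + c, c) = \sum_(l < c.+1) 'C(c, l) * 'C(j, l))%N.
  rewrite addnC -binomial.Vandermonde (reindex_inj rev_ord_inj) /=.
  apply: eq_bigr => l _; have lc : (l <= c)%N by rewrite -ltnS.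
  by rewrite subSS bin_sub// subKn.
have split_bin j l : ('C(j + b, b) * 'C(j, l) = 'C(j + b, b + l) * 'C(b + l, b))%N.
  have [lj|jl] := leqP l j; last first.
    by rewrite (@bin_small j l)// (@bin_small (j + b) (b + l)) ?muln0//; lia.
  have := bin_fact (leq_addl j b); have := bin_fact lj.
  have blj : (b + l <= j + b)%N by lia.
  have := bin_fact blj; have := bin_fact (leq_addr l b).
  rewrite addnK addKn (_ : j + b - (b + l) = j - l)%N; last by lia.
  move=> h1 h2 h3 h4.
  have pos : (0 < b`! * l`! * (j - l)`!)%N by rewrite !muln_gt0 !fact_gt0.
  apply/eqP; rewrite -(eqn_pmul2r pos); apply/eqP.
  move: h1 h2 h3 h4; move: ('C(_, _)) ('C(_, _)) ('C(_, _)) ('C(_, _)) => A B C D.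
  nia.
(* By [vdm] and [split_bin], each [l] leaves a convolution over [j], which [sum_bin_conv] evaluates
   with p = b + l. *)
have -> : (\sum_(j < t.+1) 'C(j + b, b) * 'C(j + c, c) * 'C(t - j + a, a) =
  \sum_(l < c.+1) 'C(c, l) * 'C(b + l, b) * 'C(t + a + b + 1, b + l + a + 1))%N.
  under eq_bigr do rewrite vdm big_distrr big_distrl /=.
  rewrite exchange_big /=; apply: eq_bigr => l _.
  rewrite -(@sum_bin_conv a b (b + l) t (leq_addr l b)) big_distrr /=.
  by apply: eq_bigr => j _; rewrite mulnCA -mulnA split_bin; ring.
rewrite natr_sum /betaX mulr_sumr /=; apply: eq_bigr => l _.
have f0 k : (k`!%:R : rat) != 0 by rewrite pnatr_eq0 -lt0n fact_gt0.
have bl := bin_fact (leq_addr l b); rewrite addKn in bl.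
(* Both sides equal (t + a + b + 1)! / (t - l)!, or 0 when l > t. *)
have key : ('C(t + a + b + 1, b + l + a + 1) * (a + b + l).+1`! =
            'C(t.+1 + (a + b), (a + b).+1) * 'C(t, l) * l`! * (a + b).+1`!)%N.
  have [lt|tl] := leqP l t; last first.
    by rewrite (@bin_small t l)// (@bin_small _ (b + l + a + 1)) ?muln0//; lia.
  have h1 : (b + l + a + 1 <= t + a + b + 1)%N by lia.
  have h2 : ((a + b).+1 <= t.+1 + (a + b))%N by lia.
  have := bin_fact h1; have := bin_fact h2; have := bin_fact lt.
  have -> : (t + a + b + 1 - (b + l + a + 1) = t - l)%N by lia.
  have -> : (t.+1 + (a + b) - (a + b).+1 = t)%N by lia.
  have -> : (b + l + a + 1 = (a + b + l).+1)%N by lia.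
  have -> : (t + a + b + 1 = t.+1 + (a + b))%N by lia.
  move=> <- <- /eqP; rewrite !mulnA eqn_pmul2r ?fact_gt0// => /eqP ->.
  ring.
have blR : (b + l)`!%:R = 'C(b + l, b)%:R * (b`!%:R * l`!%:R) :> rat.
  by rewrite -[in RHS]natrM -[in RHS]natrM bl.
have keyR : 'C(t + a + b + 1, b + l + a + 1)%:R * (a + b + l).+1`!%:R =
    'C(t.+1 + (a + b), (a + b).+1)%:R * 'C(t, l)%:R * l`!%:R * (a + b).+1`!%:R :> rat.
  by rewrite -[in LHS]natrM key 3![in LHS]natrM.
rewrite /beta_moment (natrM _ b`! a`!) (natrM _ (b + l)`! a`!) blR (addnA a b l).
rewrite (natrM _ ('C(c, l) * 'C(b + l, b))%N) (natrM _ 'C(c, l)) (natrM _ 'C(c, l)) /=.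
have := f0 (a + b).+1; have := f0 (a + b + l).+1; have := f0 a; have := f0 b.
move: keyR.
move: (l`!%:R : rat) (b`!%:R : rat) (a`!%:R : rat) ((a + b + l).+1`!%:R : rat).
move: ((a + b).+1`!%:R : rat) => F1 L B A F2 e nB nA nF2 nF1.
apply: (mulIf nF2); rewrite -!mulrA e; field.
by rewrite nF2 nB nA nF1.
Qed.

Definition bin3_sum (a b c t : nat) : rat :=
  (\sum_(j < t) 'C(j + b, b) * 'C(j + c, c) * 'C(t - j + a, a))%:R.

(** Here [j] stops at t - 1, so [sum_bin3E] must be used one step lower: the hockey-stick identity
    expands ['C(t - j + a, a)] into the ['C(t.-1 - j + d, d)] with d <= a, without signs. *)
Lemma nneg_bin3_sum a b c : nneg_polyfun (bin3_sum a b c).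
Proof.
have H d : nneg_polyfun (fun t => (\sum_(j < t) 'C(j + b, b) * 'C(j + c, c) *
    'C(t.-1 - j + d, d))%:R).
  have [[f f0 fE] _] := nneg_betaXY c d b.
  have m0 : 0 <= (beta_moment b d)^-1 by rewrite invr_ge0 beta_moment_ge0.
  apply: eq_nneg_polyfun (nneg_polyfunM (nneg_polyfunM (nneg_polyfun_binS (d + b))
    (nneg_polyfunC m0)) f0) => -[|t] /=.
    (* At t = 0 the binomial factor vanishes and hides the value [f 0], about which nothing is
       known. *)
    by rewrite big_ord0 bin_small// !mul0r.
  by rewrite fE sum_bin3E.
have hockey k : ('C(k.+1 + a, a) = \sum_(d < a.+1) 'C(k + d, d))%N.
  elim: a => [|a' IH]; first by rewrite big_ord1 !bin0.
  by rewrite big_ord_recr /= -IH addnS binS addSnnS addnC.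
apply: (@eq_nneg_polyfun (fun t => \sum_(d < a.+1) (\sum_(j < t) 'C(j + b, b) *
  'C(j + c, c) * 'C(t.-1 - j + d, d))%:R)); last exact: nneg_polyfun_sum.
move=> t; rewrite /bin3_sum -natr_sum exchange_big /=; congr (_%:R).
apply: eq_bigr => j _; rewrite -big_distrr /=; congr (_ * _)%N.
by rewrite -hockey; congr ('C(_ + _, _)); have := ltn_ord j; lia.
Qed.

(** * Counting points of a box by their sum *)

(* Coefficient of z^l in (1 - z)^-(a + 1) (1 - xz)^-(b + 1), as a polynomial
   in x. *)
Definition chi (l a b : nat) : {poly rat} :=
  \sum_(i < l.+1) ('C(a + (l - i), l - i) * 'C(b + i, i))%:R *: 'X^i.

(** Multiplying the generating series by 1 - z lowers [a.+1] to [a]; [chiSr] is the same with 1 - xz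
    and [b]. *)
Lemma chiSl l a b : chi l.+1 a.+1 b = chi l.+1 a b + chi l a.+1 b.
Proof.
rewrite /chi big_ord_recr [X in _ = X + _]big_ord_recr /= !subnn !bin0 addrAC.
rewrite -big_split /=; congr (_ + _); apply: eq_bigr => i _.
rewrite -scalerDl -natrD -mulnDl; congr ((_ * _)%:R *: _).
rewrite subSn; last by rewrite -ltnS.
by rewrite addnS binS addSnnS.
Qed.

Lemma chiSr l a b : chi l.+1 a b.+1 = chi l.+1 a b + 'X * chi l a b.+1.
Proof.
rewrite /chi big_ord_recl [X in _ = X + _]big_ord_recl /= !bin0 -addrA.
rewrite mulr_sumr -big_split /=; congr (_ + _); apply: eq_bigr => i _.
rewrite -scalerAr -exprS -scalerDl -natrD -mulnDr /bump leq0n add1n subSS.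
by congr ((_ * _)%:R *: _); rewrite addnS binS addSnnS.
Qed.

(** * The series K(z) and the recursion on the dimension *)

Definition psi (t i : nat) : {poly rat} :=
  'C(t + i.-1, i)%:R *: \sum_(b < i.-1) 'X^(b.+1).

(** The list keeps all earlier values, since each coefficient of the inverse series depends on all
    of them. *)
Fixpoint kap_seq (t c : nat) : seq {poly rat} :=
  if c is c'.+1 then
    rcons (kap_seq t c') (\sum_(i < c'.+1) psi t i.+1 * (kap_seq t c')`_(c' - i))
  else [:: 1].

(* [kap t c] is the coefficient of z^c in 1 / (1 - \sum_i psi t i * z^i). *)
Definition kap (t c : nat) : {poly rat} := (kap_seq t c)`_c.

Lemma size_kap_seq t c : size (kap_seq t c) = c.+1.
Proof. by elim: c => //= c IH; rewrite size_rcons IH. Qed.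

Lemma nth_kap_seq t c i : (i <= c)%N -> (kap_seq t c)`_i = kap t i.
Proof.
elim: c => [|c IH]; first by rewrite leqn0 => /eqP ->.
rewrite leq_eqVlt => /predU1P[->//|lt_ic].
by rewrite /= nth_rcons size_kap_seq lt_ic IH.
Qed.

Lemma kapS t c : kap t c.+1 = \sum_(i < c.+1) psi t i.+1 * kap t (c - i).
Proof.
rewrite /kap /= nth_rcons size_kap_seq ltnn eqxx; apply: eq_bigr => i _.
by rewrite nth_kap_seq// leq_subr.
Qed.

Definition eps (t l : nat) : {poly rat} := \sum_(i < l.+1) psi t i.

Lemma psi0 t : psi t 0 = 0. Proof. by rewrite /psi big_ord0 scaler0. Qed.

Lemma psi1 t : psi t 1 = 0. Proof. by rewrite /psi big_ord0 scaler0. Qed.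

(** Coefficient of z^s in K(z) (1 - S(z)) / (1 - z) = 1 / (1 - z), where S(z) = 1 - 1 / K(z) has the
    coefficients [psi t i]. *)
Lemma sum_kap_eps t s : \sum_(c < s.+1) kap t c * (1 - eps t (s - c)) = 1.
Proof.
elim: s => [|s IH].
  by rewrite big_ord1 /eps big_ord1 psi0 subr0 mulr1.
rewrite big_ord_recr /= subnn /eps big_ord1 psi0 subr0 mulr1 -[RHS]IH.
rewrite kapS [X in _ + X](reindex_inj rev_ord_inj) /= -big_split /=; apply: eq_bigr => c _.
have le_cs : (c <= s)%N by rewrite -ltnS.
rewrite subSS subKn// subSn// /eps [in LHS]big_ord_recr /=; ring.
Qed.

(** Effect of one more coordinate on residues: the first sum needs no borrow, the second borrows one
    [t], recorded by ['X]. The residue v = w occurs in both, for a coordinate 0 and for a coordinate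
    [t]. *)
Definition box_sum (t : nat) (f : nat -> {poly rat}) (w : nat) : {poly rat} :=
  \sum_(1 <= v < w.+1) f v + 'X * \sum_(w <= v < t.+1) f v.

Lemma box_sumS t f w : (w < t)%N ->
  box_sum t f w.+1 - box_sum t f w = f w.+1 - 'X * f w.
Proof.
move=> wt; rewrite /box_sum big_nat_recr//= [X in _ - (_ + _ * X)]big_ltn; last by lia.
ring.
Qed.

(** By [chiSl] and [chiSr] both sides have the same increment in [w]. This leaves w = 0, the case
    that dictates the choice of [psi]. *)
Lemma box_sum_chi t l w : (w <= t)%N ->
  box_sum t (fun v => chi l v (t - v)) w = chi l.+1 w (t - w) - (1 - eps t l.+1).
Proof.
elim: w => [_|w IH wt]; last first.
  have := box_sumS (fun v => chi l v (t - v)) wt.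
  move=> /eqP; rewrite subr_eq => /eqP ->; rewrite IH; last exact: ltnW.
  have -> : (t - w = (t - w.+1).+1)%N by lia.
  rewrite chiSl chiSr; ring.
rewrite /box_sum big_geq// add0r big_mkord subn0.
have -> : \sum_(v < t.+1) chi l v (t - v) =
    'C(t + l.+1, l.+1)%:R *: \sum_(i < l.+1) 'X^i.
  rewrite /chi exchange_big scaler_sumr /=; apply: eq_bigr => i _.
  rewrite -scaler_suml -natr_sum; congr (_%:R *: _).
  by rewrite sum_bin_conv//; congr ('C(_, _)); have := ltn_ord i; lia.
have -> : chi l.+1 0 t = \sum_(i < l.+2) 'C(t + i, i)%:R *: 'X^i.
  by apply: eq_bigr => i _; rewrite add0n binn mul1n.
(* The step is Pascal's rule for ['C(t + l.+2, l.+2)], whose part ['C(t + l.+1, l.+2)] is the scalar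
   in [psi t l.+2]. *)
elim: l => [|l IH].
  rewrite /eps big_ord1 !big_ord_recr big_ord0 /= psi0 psi1 big_ord0.
  rewrite bin0 expr0 expr1 !scale1r -scalerAr mulr1 !addr0 subr0 add0r.
  by rewrite addrAC subrr add0r.
have e1 : eps t l.+2 = eps t l.+1 + psi t l.+2 by rewrite /eps big_ord_recr.
rewrite e1 [in RHS]big_ord_recr /= big_ord_recr /=.
have := IH; rewrite /psi /= -!scalerAr.
have -> : 'X * \sum_(i < l.+1) 'X^i = \sum_(i < l.+1) 'X^(i.+1) :> {poly rat}.
  by rewrite mulr_sumr; apply: eq_bigr => i _; rewrite exprS.
rewrite mulrDr mulr_sumr -exprS.
rewrite [X in _ *: (X + _)](eq_bigr (fun i : 'I__ => 'X^(i.+1))); last first.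
  by move=> i _; rewrite exprS.
move: (\sum_(i < l.+1) 'X^(i.+1)) => S; move: (\sum_(i < l.+2) _) => T e2.
have bS : 'C(t + l.+2, l.+2)%:R = 'C(t + l.+1, l.+2)%:R + 'C(t + l.+1, l.+1)%:R :> rat.
  by rewrite [in LHS]addnS binS natrD.
rewrite scalerDr {1}bS scalerDl e2; ring.
Qed.

(* For 1 <= w <= t, the coefficient of x^k in [gam t s w] is the number of
   y in {0, ..., t}^s with sum kt + w. *)
Definition gam (t s w : nat) : {poly rat} :=
  \sum_(c < s) kap t c * chi (s.-1 - c) w (t - w).

(** The 1 stands for the first [s] coordinates being zero, as 0 is no kt + v with k >= 0 and 1 <= v
    <= t. By [sum_kap_eps] it cancels the defects [1 - eps] from [box_sum_chi]. *)
Lemma gamS t s w : (w <= t)%N -> gam t s.+1 w = 1 + box_sum t (gam t s) w.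
Proof.
move=> wt.
have -> : box_sum t (gam t s) w =
    \sum_(c < s) kap t c * box_sum t (fun v => chi (s.-1 - c) v (t - v)) w.
  rewrite /box_sum /gam exchange_big [X in _ + 'X * X]exchange_big /= mulr_sumr.
  rewrite -big_split /=; apply: eq_bigr => c _.
  by rewrite -!mulr_sumr; ring.
rewrite -[X in X + _](sum_kap_eps t s) big_ord_recr /= subnn.
rewrite addrAC -big_split /= /gam big_ord_recr /=; congr (_ + _).
  apply: eq_bigr => c _; rewrite box_sum_chi//.
  have -> : ((s.-1 - c).+1 = s - c)%N by have := ltn_ord c; lia.
  ring.
by rewrite subnn /chi big_ord1 /eps big_ord1 psi0 !bin0 scale1r subr0 expr0.
Qed.

(** * Coefficients of the powers of 1 + x + ... + x^t *)

Definition box_poly (t : nat) : {poly rat} := \sum_(i < t.+1) 'X^i.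

Lemma coef_box_poly t i : (box_poly t)`_i = (i <= t)%N%:R.
Proof.
have -> : box_poly t = \poly_(i < t.+1) 1.
  by rewrite poly_def; apply: eq_bigr => j _; rewrite scale1r.
by rewrite coef_poly ltnS; case: leq.
Qed.

Lemma coef_box_polyS t s N :
  (box_poly t ^+ s.+1)`_N = \sum_(N - t <= u < N.+1) (box_poly t ^+ s)`_u.
Proof.
rewrite exprS coefMr -(big_mkord xpredT (fun j => (box_poly t)`_(N - j) * (box_poly t ^+ s)`_j)).
rewrite (big_cat_nat (n := N - t)) //=; last by lia.
rewrite big_nat big1 ?add0r => [|u /andP[_ lt_u]]; last first.
  by rewrite coef_box_poly leqNgt (_ : (t < N - u)%N) ?mul0r//; lia.
rewrite big_nat [RHS]big_nat; apply: eq_bigr => u /andP[le_u _].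
by rewrite coef_box_poly (_ : (N - u <= t)%N) ?mul1r//; lia.
Qed.

(* Split y_(s+1) according to whether it is less than w (no borrow from k) or
   not; this is the recursion [gamS]. *)
Lemma coef_box_poly_gam t s k w : (0 < w <= t)%N ->
  (box_poly t ^+ s)`_(k * t + w) = (gam t s w)`_k.
Proof.
elim: s k w => [|s IH] k w /andP[w0 wt].
  by rewrite expr0 coef1 /gam big_ord0 coef0 addn_eq0 (gtn_eqF w0) andbF.
rewrite coef_box_polyS gamS// !coefD coef1 coefXM !coef_sum.
case: k => [|k] /=.
  (* The window now reaches down to u = 0, whose coefficient is the 1 of [gamS]. *)
  rewrite mul0n !add0n (_ : w - t = 0)%N; last by lia.
  rewrite big_ltn// addr0; congr (_ + _).
    by elim: (s) => [|s' IHs]; rewrite ?expr0 ?coef1// exprS coef0M IHs coef_box_poly mul1r.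
  rewrite big_nat [RHS]big_nat; apply: eq_bigr => v hv.
  by rewrite -IH ?mul0n ?add0n//; lia.
rewrite add0r (_ : k.+1 * t + w - t = k * t + w)%N; last by rewrite mulSn; lia.
(* Cut the window after (k + 1)t: the lower part borrows from [k.+1], the upper part does not. *)
rewrite (big_cat_nat (n := (k * t + t).+1)) /=; try by rewrite ?mulSn; lia.
rewrite addrC; congr (_ + _).
  rewrite -[(k * t + t).+1]add1n (_ : (k.+1 * t + w).+1 = w.+1 + (k * t + t))%N; last by lia.
  rewrite big_addn addnK big_nat [RHS]big_nat; apply: eq_bigr => v hv.
  by rewrite -IH; [congr (_`_ _); lia | lia].
rewrite (addnC _ w) (_ : (k * t + t).+1 = t.+1 + k * t)%N; last by lia.
rewrite big_addn addnK.
rewrite big_nat [RHS]big_nat; apply: eq_bigr => v hv.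
by rewrite -IH; [congr (_`_ _); lia | lia].
Qed.

(** * Nonnegativity in t of coefficients in x *)

Definition nneg_coefs (F : nat -> {poly rat}) : Prop :=
  forall k, nneg_polyfun (fun t => (F t)`_k).

Lemma eq_nneg_coefs F G : F =1 G -> nneg_coefs F -> nneg_coefs G.
Proof. by move=> FG hF k; apply: eq_nneg_polyfun (hF k) => t; rewrite FG. Qed.

Lemma nneg_coefsM F G :
  nneg_coefs F -> nneg_coefs G -> nneg_coefs (fun t => F t * G t).
Proof.
move=> hF hG k; apply: (@eq_nneg_polyfun (fun t => \sum_(i < k.+1) (F t)`_i * (G t)`_(k - i))).
  by move=> t; rewrite coefM.
by apply: nneg_polyfun_sum => i _; apply: nneg_polyfunM.
Qed.

Lemma nneg_coefs_sum n (F : 'I_n -> nat -> {poly rat}) :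
  (forall i, nneg_coefs (F i)) -> nneg_coefs (fun t => \sum_(i < n) F i t).
Proof.
move=> hF k; apply: (@eq_nneg_polyfun (fun t => \sum_(i < n) (F i t)`_k)).
  by move=> t; rewrite coef_sum.
by apply: nneg_polyfun_sum => i _; apply: hF.
Qed.

Lemma nneg_coefsZXn f n :
  nneg_polyfun f -> nneg_coefs (fun t => f t *: 'X^n).
Proof.
move=> hf k; apply: (@eq_nneg_polyfun (fun t => f t * (k == n)%:R)).
  by move=> t; rewrite coefZ coefXn.
by apply: nneg_polyfunM => //; apply: nneg_polyfunC; rewrite ler0n.
Qed.

Lemma nneg_psi i : nneg_coefs (psi^~ i).
Proof.
apply: (@eq_nneg_coefs (fun t => \sum_(b < i.-1) 'C(t + i.-1, i)%:R *: 'X^(b.+1))).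
  by move=> t; rewrite /psi scaler_sumr.
apply: nneg_coefs_sum => b; apply: nneg_coefsZXn.
by case: i b => [[//]|i b]; apply: nneg_polyfun_binS.
Qed.

Lemma nneg_kap c : nneg_coefs (kap^~ c).
Proof.
elim/ltn_ind: c => -[_|c IH].
  apply: (@eq_nneg_coefs (fun t => 1 *: 'X^0)).
    by move=> t; rewrite scale1r.
  exact/nneg_coefsZXn/nneg_polyfunC.
apply: (@eq_nneg_coefs (fun t => \sum_(i < c.+1) psi t i.+1 * kap t (c - i))).
  by move=> t; rewrite kapS.
apply: nneg_coefs_sum => i; apply: nneg_coefsM (nneg_psi _) (IH _ _).
by rewrite ltnS leq_subr.
Qed.

(** At w = t the factor (1 - xz)^-(t-w+1) no longer involves [t]. *)
Lemma nneg_gam_diag s : nneg_coefs (fun t => gam t s t).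
Proof.
apply: nneg_coefs_sum => c; apply: nneg_coefsM (nneg_kap _) _.
apply: nneg_coefs_sum => i; apply: nneg_coefsZXn.
apply: eq_nneg_polyfun (nneg_polyfun_bin (s.-1 - c - i)) => t.
by rewrite subnn add0n binn muln1.
Qed.

(** [kap] does not depend on the residue, so the sum over [j] only meets [chi], whose coefficients
    turn it into [bin3_sum]. *)
Lemma nneg_sum_gam s q :
  nneg_coefs (fun t => \sum_(j < t) 'C(j + q, q)%:R *: gam t s (t - j)).
Proof.
apply: (@eq_nneg_coefs (fun t => \sum_(c < s) kap t c *
    \sum_(i < (s.-1 - c).+1) bin3_sum (s.-1 - c - i) i q t *: 'X^i)).
  move=> t; under [RHS]eq_bigr do rewrite /gam scaler_sumr.
  rewrite exchange_big /=; apply: eq_bigr => c _.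
  under [RHS]eq_bigr do rewrite scalerAr.
  rewrite -mulr_sumr; congr (_ * _).
  under [RHS]eq_bigr do rewrite /chi scaler_sumr.
  rewrite exchange_big /=; apply: eq_bigr => i _.
  rewrite /bin3_sum natr_sum scaler_suml; apply: eq_bigr => j _.
  rewrite scalerA -natrM subKn; last exact: ltnW.
  by congr (_%:R *: _); ring.
apply: nneg_coefs_sum => c; apply: nneg_coefsM (nneg_kap _) _.
by apply: nneg_coefs_sum => i; apply/nneg_coefsZXn/nneg_bin3_sum.
Qed.

(* This fails for r > s, where the value is 1 at t = 0 and 0 for t > 0. *)
Lemma nneg_box_poly_diag r s : (r <= s)%N ->
  nneg_polyfun (fun t => (box_poly t ^+ s)`_(r * t)).
Proof.
have box0 t n : (box_poly t ^+ n)`_0 = 1.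
  by elim: n => [|n IH]; rewrite ?expr0 ?coef1// exprS coef0M IH coef_box_poly mul1r.
case: r => [|k] ks.
  by apply: eq_nneg_polyfun (nneg_polyfunC ler01) => t; rewrite box0.
apply: eq_nneg_polyfun (@nneg_gam_diag s k) => -[|t]; last first.
  by rewrite -coef_box_poly_gam ?leqnn// mulSn addnC.
(* At t = 0 only c = 0 contributes and [gam] is 1 + x + ... + x^(s-1); its coefficient at [k] is 1
   because k < s. *)
rewrite muln0 box0 /gam; case: s ks => // s ks.
rewrite big_ord_recl big1 => [|i _]; last first.
  rewrite lift0 kapS big1 ?mul0r// => j _.
  by rewrite /psi bin_small// scale0r mul0r.
rewrite addr0 /kap /= mul1r subn0 /chi coef_sum.
rewrite (bigD1 (Ordinal (ks : (k < s.+1)%N)))//= big1.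
  by rewrite !add0n !binn scale1r coefXn eqxx addr0.
move=> i /eqP ik; rewrite !add0n !binn scale1r coefXn; case: eqP => // ki.
by case: ik; apply/val_inj.
Qed.

Lemma nneg_box_poly_tail r s q :
  nneg_polyfun (fun t =>
    \sum_(j < t) 'C(j + q, q)%:R * (box_poly t ^+ s)`_(r.+1 * t - j)).
Proof.
apply: eq_nneg_polyfun (@nneg_sum_gam s q r) => t.
rewrite coef_sum; apply: eq_bigr => j _; rewrite coefZ -coef_box_poly_gam.
  by congr (_ * _`_ _); rewrite mulSn; have := ltn_ord j; lia.
by rewrite subn_gt0 ltn_ord leq_subr.
Qed.

(** Stars and bars: a sum of at most [t] makes the upper bounds on the entries void. *)
Lemma coef_box_poly_simplex t q N : (N <= t)%N ->
  (box_poly t ^+ q.+1)`_N = 'C(N + q, q)%:R.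
Proof.
elim: q N => [|q IH] N Nt; first by rewrite expr1 coef_box_poly Nt bin0.
rewrite coef_box_polyS (_ : N - t = 0)%N; last by lia.
rewrite big_mkord (eq_bigr (fun u : 'I_N.+1 => 'C(u + q, q)%:R)); last first.
  by move=> u _; apply: IH; have := ltn_ord u; lia.
rewrite -natr_sum (eq_bigr (fun u : 'I_N.+1 => 'C(u + q, q) * 'C(N - u + 0, 0))%N).
  by rewrite sum_bin_conv//; congr ('C(_, _)%:R); lia.
by move=> u _; rewrite bin0 muln1.
Qed.

Lemma card_box_sum (s t N : nat) :
  #|[set f : {ffun 'I_s -> 'I_t.+1} | \sum_i f i == N :> nat]|%N%:R =
  (box_poly t ^+ s)`_N.
Proof.
rewrite -[in RHS](card_ord s) -prodr_const bigA_distr_bigA coef_sum /=.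
rewrite -sum1_card natr_sum big_mkcond /=; apply: eq_bigr => f _.
by rewrite inE prodrXr coefXn eq_sym; case: eqP.
Qed.

Lemma card_box_pair_sum (s m t N : nat) :
  #|[set fg : {ffun 'I_s -> 'I_t.+1} * {ffun 'I_m -> 'I_t.+1} |
      (\sum_i fg.1 i + \sum_i fg.2 i == N)%N && (\sum_i fg.2 i <= t)%N]|%N%:R =
  \sum_(j < t.+1 | (j <= N)%N) (box_poly t ^+ s)`_(N - j) * (box_poly t ^+ m)`_j.
Proof.
under eq_bigr => j _ do rewrite -!card_box_sum -natrM -cardsX.
rewrite -natr_sum; congr (_%:R).
rewrite -sum1_card (partition_big (fun fg : {ffun 'I_s -> 'I_t.+1} * {ffun 'I_m -> 'I_t.+1} =>
    inord (\sum_i fg.2 i) : 'I_t.+1)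
  (fun j => (j <= N)%N)) /=; last first.
  by move=> [f g]; rewrite inE /= => /andP[/eqP <- le]; rewrite inordK// leq_addl.
apply: eq_bigr => j jN; rewrite -sum1_card; apply: eq_bigl => -[f g].
rewrite !inE /=; apply/idP/idP.
  by case/andP=> /andP[/eqP <- le] /eqP <-; rewrite inordK// addnK !eqxx.
case/andP=> /eqP -> /eqP ej; rewrite ej subnK// eqxx -ltnS ltn_ord /=.
by apply/eqP/val_inj; rewrite /= inordK.
Qed.

Lemma card_box_simplex_pair (s q t N : nat) :
  #|[set fg : {ffun 'I_s -> 'I_t.+1} * {ffun 'I_q.+1 -> 'I_t.+1} |
      (\sum_i fg.1 i == N)%N && (\sum_i fg.2 i == t)%N]|%N%:R =
  (box_poly t ^+ s)`_N * 'C(t + q, q)%:R.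
Proof.
rewrite -(@coef_box_poly_simplex t q t)// -!card_box_sum -natrM -cardsX.
by congr (_%:R); apply: eq_card => fg; rewrite !inE.
Qed.

(** * Lattice points of dilates *)

Local Open Scope classical_set_scope.
Local Open Scope card_scope.

Lemma card_eq_image_finset (T : finType) (U : Type) (A : {set T}) (h : T -> U) :
  injective h -> [set h x | x in [set x | x \in A]] #= `I_#|A|%N.
Proof.
move=> inj_h.
have -> : [set h x | x in [set x | x \in A]] =
    [set h (enum_val i) | i in [set: 'I_#|A|]].
  apply/seteqP; split => _ [x /= xA <-]; last by exists (enum_val x) => //; exact: enum_valP.
  by exists (enum_rank_in xA x) => //; rewrite enum_rankK_in.
apply: card_eq_trans (_ : [set: 'I_#|A|] #= _); last by rewrite card_eq_sym card_II.
apply: inj_card_eq => i j _ _ /inj_h; exact: enum_val_inj.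
Qed.

Lemma exists_finset_between (T : finType) (A C : {set T}) (k : nat) :
  (A \subset C)%SET -> (#|A| <= k <= #|C|)%N ->
  exists B : {set T}, [/\ (A \subset B)%SET, (B \subset C)%SET & #|B| = k].
Proof.
move=> AC /andP[Ak]; have <- := subnKC Ak; elim: (k - #|A|)%N => {k Ak} [|d IHd] kC.
  by exists A; rewrite addn0; split.
have [|B [AB BC cB]] := IHd; first by lia.
have : (B \proper C)%SET by rewrite properEcard BC cB; lia.
case/fintype.properP => _ [x xC xB]; exists (x |: B)%SET; split.
- by apply: fintype.subset_trans AB _; apply: finset.subsetUr.
- by rewrite finset.subUset finset.sub1set xC.
- by rewrite cardsU1 xB cB; lia.
Qed.

(** Subtracting the indicator of [B] must leave entries between 0 and [t]. The two bounds on the sum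
    give at most [k] entries equal to t + 1 and at least [k] positive ones, so a [B] of size [k]
    fits between. *)
Lemma exists_peel (T : finType) (t k : nat) (H : {set T}) (f : T -> nat) :
  (forall i, i \in H -> f i <= t.+1)%N ->
  (\sum_(i in H) f i <= k * t.+1)%N ->
  (k * t.+1 < \sum_(i in H) f i + t.+1)%N ->
  exists B : {set T}, [/\ (B \subset H)%SET, #|B| = k,
    (forall i, i \in B -> 0 < f i)%N &
    (forall i, i \in H -> f i = t.+1 -> i \in B)].
Proof.
move=> ft le_k lt_k.
pose A := [set i in H | f i == t.+1]%SET; pose C := [set i in H | 0 < f i]%N%SET.
have AC : (A \subset C)%SET.
  by apply/fintype.subsetP => i; rewrite !inE => /andP[-> /eqP ->].
have cA : (#|A| * t.+1 <= \sum_(i in H) f i)%N.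
  rewrite -sum_nat_const [leqRHS](big_setID A) /= (finset.setIidPr _); last first.
    by apply/fintype.subsetP => i; rewrite inE => /andP[].
  apply: leq_trans (leq_addr _ _).
  by apply: leq_sum => i; rewrite inE => /andP[_ /eqP ->].
have cC : (\sum_(i in H) f i <= #|C| * t.+1)%N.
  rewrite -sum_nat_const [leqLHS](big_setID C) /= (finset.setIidPr _); last first.
    by apply/fintype.subsetP => i; rewrite inE => /andP[].
  rewrite [X in (_ + X)%N]big1 ?addn0 => [|i].
    by apply: leq_sum => i; rewrite inE => /andP[/ft].
  by rewrite !inE => /andP[+ iH]; rewrite iH /= lt0n negbK => /eqP.
have [|B [AB BC cB]] := @exists_finset_between _ A C k AC.
  by apply/andP; split; rewrite -ltnS -(ltn_pmul2r (ltn0Sn t)); nia.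
exists B; split => //.
- by apply: fintype.subset_trans BC _; apply/fintype.subsetP => i; rewrite inE => /andP[].
- by move=> i /(fintype.subsetP BC); rewrite inE => /andP[].
- by move=> i iH fi; apply: (fintype.subsetP AB); rewrite inE iH fi eqxx.
Qed.

(** Common form of [base_polytope] and [hypersimplex], convertible to both. *)
Definition indicator_hull (R : realType) (n : nat) (F : {set {set 'I_n}}) :
    set 'rV[R]_n :=
  conv_hull [set indicator_vec R B | B in [set B | B \in F]].
Arguments indicator_hull R {n} F _.

Lemma convex_conv_hull (R : realType) n (V : set 'rV[R]_n) : convex_set (conv_hull V).
Proof.
move=> x y l; rewrite !inE => hx hy A AV.
by apply/set_mem; apply: AV.1; apply/mem_set; [apply: hx | apply: hy].
Qed.

Lemma dilateS_indicator (R : realType) n (F : {set {set 'I_n}}) t (x : 'rV[R]_n) (B : {set 'I_n}) :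
  B \in F -> dilate t (indicator_hull R F) x ->
  dilate t.+1 (indicator_hull R F) (x + indicator_vec R B).
Proof.
move=> BF [y hy <-].
have t0 : (0 : R) <= t.+1%:R^-1 by rewrite invr_ge0.
have t1 : t.+1%:R^-1 <= (1 : R) by rewrite invf_le1 ?ltr0n// ler1n.
have hB : indicator_vec R B \in indicator_hull R F.
  by apply/mem_set => A [_ VA]; apply: VA; exists B.
(* Divided by t + 1, the new point is the convex combination of the vertex, with weight 1 / (t + 1),
   and [y]. *)
have := convex_conv_hull (Itv01 t0 t1) hB (mem_set hy).
move=> /set_mem h; exists (t.+1%:R^-1 *: indicator_vec R B + (1 - t.+1%:R^-1) *: y) => //.
have nz : t.+1%:R != 0 :> R by rewrite pnatr_eq0.
rewrite scalerDr !scalerA divff// scale1r addrC; congr (_ *: _ + _).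
by rewrite mulrBr divff// mulr1 -natr1 addrK.
Qed.

Lemma dilate0_hull (R : realType) n (F : {set {set 'I_n}}) (x : 'rV[R]_n) :
  F != finset.set0 -> x = 0 -> dilate 0 (indicator_hull R F) x.
Proof.
case/finset.set0Pn => B BF ->; exists (indicator_vec R B); last by rewrite scale0r.
by move=> A [_ VA]; apply: VA; exists B.
Qed.

(** A half-space is convex, so by minimality of the hull it contains the polytope once it contains
    the vertices. *)
Lemma lattice_points_dilate_le (R : realType) n (F : {set {set 'I_n}}) t
    (z : 'rV[int]_n) (c : 'I_n -> int) (b : int) :
  (forall B, B \in F -> \sum_(i in B) c i <= b) ->
  lattice_points (dilate t (indicator_hull R F)) z -> \sum_i c i * z ord0 i <= t%:Z * b.
Proof.
move=> hF [x hx xz].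
have : [set y : 'rV[R]_n | \sum_i (c i)%:~R * y ord0 i <= b%:~R] x.
  apply: hx; split => [y y' l|_ [B BF <-] /=].
    rewrite !inE /= => hy hy'.
    have l0 : 0 <= l%:num by [].
    have l1 : l%:num <= 1 by [].
    rewrite [X in X <= _](_ : _ = l%:num * (\sum_i (c i)%:~R * (y : 'rV[R]_n) ord0 i) +
      (1 - l%:num) * (\sum_i (c i)%:~R * (y' : 'rV[R]_n) ord0 i)); last first.
      rewrite !mulr_sumr -big_split /=; apply: eq_bigr => i _.
      rewrite !mxE /unstable.onem; ring.
    have -> : b%:~R = l%:num * b%:~R + (1 - l%:num) * b%:~R :> R by ring.
    by apply: lerD; rewrite ler_wpM2l// subr_ge0.
  rewrite (eq_bigr (fun i => (if i \in B then c i else 0)%:~R)).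
    by rewrite -rmorph_sum /= ler_int -big_mkcond hF.
  by move=> i _; rewrite mxE; case: ifP; rewrite ?mulr1 ?mulr0.
move=> /= hx'.
rewrite -(ler_int R) rmorph_sum rmorphM /=.
apply: le_trans (_ : t%:R * \sum_i (c i)%:~R * x ord0 i <= _); last first.
  by rewrite ler_wpM2l.
rewrite mulr_sumr; apply: ler_sum => i _.
have /(congr1 (fun M : 'rV[R]_n => M ord0 i)) := xz; rewrite !mxE rmorphM /= => <-.
by rewrite mulrCA.
Qed.


Definition natvec (R : pzSemiRingType) (n : nat) (f : 'I_n -> nat) : 'rV[R]_n :=
  \row_i (f i)%:R.

Lemma natvec_subK (R : pzSemiRingType) n (f : 'I_n -> nat) (B : {set 'I_n}) :
  (forall i, i \in B -> 0 < f i)%N ->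
  natvec R f = natvec R (fun i => f i - (i \in B))%N + \row_i (i \in B)%:R.
Proof.
move=> f0; apply/rowP => i; rewrite !mxE -natrD subnK//.
by case: (boolP (i \in B)) => // /f0.
Qed.

Lemma sum_subn_mem (T : finType) (P : pred T) (f : T -> nat) (B : {set T}) :
  (forall i, i \in B -> 0 < f i)%N ->
  (\sum_(i | P i) (f i - (i \in B)) + #|[set i in B | P i]%SET| = \sum_(i | P i) f i)%N.
Proof.
move=> f0; have -> : #|[set i in B | P i]%SET| = (\sum_(i | P i) (i \in B))%N.
  rewrite -sum1_card -big_mkcondr; apply: eq_bigl => i.
  by rewrite inE andbC.
rewrite -big_split /=; apply: eq_bigr => i _; rewrite subnK//.
by case: (boolP (i \in B)) => // /f0.
Qed.

(** Integer decomposition: induction on [t] peels off one basis at a time. *)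
Lemma natvec_hypersimplex (R : realType) a n t (f : 'I_n -> nat) :
  (a <= n)%N -> (forall i, f i <= t)%N -> (\sum_i f i = a * t)%N ->
  dilate t (hypersimplex R a n) (natvec R f).
Proof.
move=> an; elim: t f => [|t IH] f ft sf.
  apply: (@dilate0_hull R n (uniform_bases a n)); first exact: uniform_bases_neq0.
  by apply/rowP => i; rewrite !mxE; have := ft i; rewrite leqn0 => /eqP ->.
have [i _|||B [_ cB f0 fT]] := @exists_peel _ t a [set: 'I_n]%SET f.
- exact: ft.
- by under eq_bigl do rewrite inE; rewrite sf.
- by under eq_bigl do rewrite inE; rewrite sf; lia.
rewrite (natvec_subK _ f0).
apply: (@dilateS_indicator R n (uniform_bases a n)); first by rewrite inE cB.
apply: IH => [i|].
  have := ft i; rewrite leq_eqVlt => /predU1P[fi|]; last by lia.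
  by rewrite fT ?inE// fi; lia.
have := sum_subn_mem xpredT f0; rewrite sf mulnS.
have -> : #|[set i in B | true]%SET| = a.
  by rewrite -cB; apply: eq_card => i; rewrite inE andbT.
by rewrite addnC => /addnI.
Qed.

Lemma natvec_panhandle (R : realType) r s n t (f : 'I_n -> nat) :
  (0 < r)%N -> (r <= s)%N -> (s < n)%N ->
  (forall i, f i <= t)%N -> (\sum_i f i = r * t)%N ->
  (\sum_(i | i \notin initial s n) f i <= t)%N ->
  dilate t (indicator_hull R (panhandle_bases r s n)) (natvec R f).
Proof.
move=> r0 rs sn; elim: t f => [|t IH] f ft sf tf.
  apply: dilate0_hull; first exact: panhandle_bases_neq0.
  by apply/rowP => i; rewrite !mxE; have := ft i; rewrite leqn0 => /eqP ->.
have [B [BF f0 fT tB]] : exists B : {set 'I_n}, [/\ B \in panhandle_bases r s n,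
    (forall i, i \in B -> 0 < f i)%N, (forall i, f i = t.+1 -> i \in B) &
    (\sum_(i | i \notin initial s n) f i <= t + #|B :\: initial s n|)%N].
  have split_sum : (\sum_(i in initial s n) f i +
      \sum_(i | i \notin initial s n) f i = r * t.+1)%N.
    by rewrite -sf [RHS](bigID (mem (initial s n))).
  (* If the sum outside [initial s n] is tight, the peeled basis takes one element there and r - 1
     inside; if it is slack, all [r] are taken inside. *)
  move: tf; rewrite leq_eqVlt => /predU1P[tf|tf].
    have rE : r = (r - 1).+1 by lia.
    have [i _|||B1 [sB1 cB1 f1 fT1]] := @exists_peel _ t (r - 1) (initial s n) f.
    - exact: ft.
    - by move: split_sum; rewrite tf {1}rE; lia.
    - by move: split_sum; rewrite tf {1}rE; lia.
    have tfC : (\sum_(i in ~: initial s n) f i = t.+1)%N.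
      by rewrite -tf; apply: eq_bigl => i; rewrite inE.
    have [i _|||B2 [sB2 cB2 f2 fT2]] := @exists_peel _ t 1 (~: initial s n)%SET f.
    - exact: ft.
    - by rewrite tfC mul1n.
    - by rewrite tfC mul1n; lia.
    have e1 : ((B1 :|: B2) :&: initial s n = B1)%SET.
      apply/setP => i; rewrite !inE; have := fintype.subsetP sB1 i.
      have := fintype.subsetP sB2 i; rewrite !inE.
      case: (i \in B1) => /=; first by move=> _ ->.
      by case: (i \in B2) => // /(_ isT) /negbTE ->.
    have e2 : ((B1 :|: B2) :\: initial s n = B2)%SET.
      apply/setP => i; rewrite !inE; have := fintype.subsetP sB1 i.
      have := fintype.subsetP sB2 i; rewrite !inE.
      case: (i \in B2) => /=; first by move=> -> //; rewrite orbT.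
      by case: (i \in B1) => [_ ->|]//; rewrite andbF.
    exists (B1 :|: B2)%SET; split.
    - rewrite inE -(cardsID (initial s n)) e1 e2 cB1 cB2 leqnn andbT; lia.
    - by move=> i; rewrite inE => /orP[/f1|/f2].
    - move=> i fi; rewrite inE; have [/fT1 ->//|ni] := boolP (i \in initial s n).
      by rewrite fT2 ?orbT// inE.
    - by rewrite e2 cB2 tf addn1.
  have [i _|||B [sB cB f0 fT]] := @exists_peel _ t r (initial s n) f.
  - exact: ft.
  - by move: split_sum; lia.
  - by move: split_sum; lia.
  exists B; split => //.
  - by rewrite inE (finset.setIidPl sB) cB eqxx leq_subr.
  - move=> i fi; apply: fT => //; apply/negPn/negP => ni.
    by move: tf; rewrite (bigD1 i)//= fi; lia.
  - by apply: leq_trans (leq_addr _ _); rewrite -ltnS.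
rewrite (natvec_subK _ f0); apply: dilateS_indicator => //; apply: IH => [i||].
- have := ft i; rewrite leq_eqVlt => /predU1P[fi|]; last by lia.
  by rewrite fT ?inE// fi; lia.
- have := sum_subn_mem xpredT f0; rewrite sf mulnS.
  have -> : #|[set i in B | true]%SET| = r.
    move: BF; rewrite inE => /andP[/eqP <- _].
    by apply: eq_card => i; rewrite inE andbT.
  by rewrite addnC => /addnI.
- have := sum_subn_mem (fun i => i \notin initial s n) f0.
  have -> : #|[set i in B | i \notin initial s n]%SET| = #|B :\: initial s n|.
    by apply: eq_card => i; rewrite !inE andbC.
  by move=> e; move: tB; rewrite -e leq_add2r.
Qed.

Lemma map_natvec (R : realType) n (f : 'I_n -> nat) :
  map_mx intr (natvec int f) = natvec R f.
Proof. by apply/rowP => i; rewrite !mxE natz. Qed.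

Definition box_vec n t (f : {ffun 'I_n -> 'I_t.+1}) : 'rV[int]_n :=
  natvec int (fun i => f i).

Lemma box_vec_inj n t : injective (@box_vec n t).
Proof.
move=> f g fg; apply/ffunP => i; apply/val_inj.
have /(congr1 (fun M : 'rV[int]_n => M ord0 i)) := fg; rewrite /box_vec !mxE !natz.
by case.
Qed.

(** Vertices have entries 0 and 1, so the coordinate functionals confine the lattice points to a
    finite box. *)
Lemma lattice_points_natvec (R : realType) n (F : {set {set 'I_n}}) t (z : 'rV[int]_n) :
  lattice_points (dilate t (indicator_hull R F)) z ->
  exists f : {ffun 'I_n -> 'I_t.+1}, z = box_vec f.
Proof.
move=> hz.
have z0 i : 0 <= z ord0 i.
  have := @lattice_points_dilate_le R n F t z (fun j => - (j == i)%:Z) 0 _ hz.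
  rewrite (bigD1 i)//= eqxx big1 => [|j /negbTE->]; last by rewrite oppr0 mul0r.
  rewrite mulN1r addr0 mulr0 oppr_le0; apply=> B _.
  by apply: sumr_le0 => j _; rewrite oppr_le0.
have zt i : z ord0 i <= t%:Z.
  have := @lattice_points_dilate_le R n F t z (fun j => (j == i)%:Z) 1 _ hz.
  rewrite (bigD1 i)//= eqxx big1 => [|j /negbTE->]; last by rewrite mul0r.
  rewrite mul1r addr0 mulr1; apply=> B _.
  have [iB|iB] := boolP (i \in B).
    by rewrite (bigD1 i)//= eqxx big1 ?addr0// => j /andP[_ /negbTE ->].
  by rewrite big1// => j jB; case: eqP iB => // <-; rewrite jB.
exists [ffun i => inord `|z ord0 i|%N]; apply/rowP => i; rewrite !mxE ffunE natz.
have := z0 i; have := zt i; case: (z ord0 i) => // k.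
by rewrite absz_nat lez_nat => kt _; rewrite inordK.
Qed.

Lemma lattice_points_sum_le (R : realType) n (F : {set {set 'I_n}}) t k (P : pred 'I_n)
    (f : 'I_n -> nat) :
  (forall B, B \in F -> #|[set i in B | P i]%SET| <= k)%N ->
  lattice_points (dilate t (indicator_hull R F)) (natvec int f) ->
  (\sum_(i | P i) f i <= k * t)%N.
Proof.
move=> hF hf.
have := @lattice_points_dilate_le R n F t _ (fun j => (P j)%:Z) k _ hf.
rewrite (eq_bigr (fun i => if P i then (f i)%:Z else 0)); last first.
  by move=> i _; rewrite mxE natz; case: (P i); rewrite ?mul1r ?mul0r.
rewrite -big_mkcond /= -(big_morph Posz PoszD (erefl _)) -PoszM lez_nat mulnC; apply.
move=> B /hF; rewrite -sum1_card -lez_nat; apply: le_trans.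
rewrite (big_morph Posz PoszD (erefl _)) [leRHS]big_mkcond [leLHS]big_mkcond /=.
by apply: ler_sum => i _; rewrite inE; case: (i \in B); case: (P i).
Qed.

Lemma lattice_points_sum_ge (R : realType) n (F : {set {set 'I_n}}) t k
    (f : 'I_n -> nat) :
  (forall B, B \in F -> k <= #|B|)%N ->
  lattice_points (dilate t (indicator_hull R F)) (natvec int f) ->
  (k * t <= \sum_i f i)%N.
Proof.
move=> hF hf.
have := @lattice_points_dilate_le R n F t _ (fun=> -1) (- k%:Z) _ hf.
rewrite (eq_bigr (fun i => - (f i)%:Z)); last by move=> i _; rewrite mxE natz mulN1r.
rewrite sumrN -(big_morph Posz PoszD (erefl _)) mulrN lerN2 -PoszM lez_nat mulnC; apply.
move=> B /hF; rewrite -sum1_card -lez_nat sumrN lerN2.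
by rewrite (big_morph Posz PoszD (erefl _)).
Qed.

Lemma lattice_points_hypersimplex (R : realType) a n t (f : {ffun 'I_n -> 'I_t.+1}) :
  (a <= n)%N ->
  lattice_points (dilate t (hypersimplex R a n)) (box_vec f) <->
  (\sum_i f i = a * t)%N.
Proof.
move=> an; split=> [hf|sf]; last first.
  rewrite /lattice_points /box_vec /= map_natvec; apply: natvec_hypersimplex => // i.
  by rewrite -ltnS.
apply/eqP; rewrite eqn_leq; apply/andP; split.
  apply: (lattice_points_sum_le (F := uniform_bases a n)) hf => B.
  rewrite inE => /eqP <-; apply: subset_leq_card.
  by apply/fintype.subsetP => i; rewrite inE => /andP[].
apply: (lattice_points_sum_ge (F := uniform_bases a n)) hf => B.
by rewrite inE => /eqP ->.
Qed.

Lemma lattice_points_panhandle (R : realType) r s n t (f : {ffun 'I_n -> 'I_t.+1}) :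
  (0 < r)%N -> (r <= s)%N -> (s < n)%N ->
  lattice_points (dilate t (indicator_hull R (panhandle_bases r s n))) (box_vec f) <->
  (\sum_i f i = r * t /\ \sum_(i | i \notin initial s n) f i <= t)%N.
Proof.
move=> r0 rs sn; split=> [hf|[sf tf]]; last first.
  rewrite /lattice_points /box_vec /= map_natvec; apply: natvec_panhandle => // i.
  by rewrite -ltnS.
split.
  apply/eqP; rewrite eqn_leq; apply/andP; split.
    apply: lattice_points_sum_le hf => B.
    rewrite inE => /andP[/eqP <- _]; apply: subset_leq_card.
    by apply/fintype.subsetP => i; rewrite inE => /andP[].
  apply: lattice_points_sum_ge hf => B.
  by rewrite inE => /andP[/eqP -> _].
(* The factor is 1 because a basis has at most one element outside [initial s n]. *)
rewrite -[leqRHS]mul1n; apply: lattice_points_sum_le hf => B.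
rewrite inE -(cardsID (initial s n)) => /andP[/eqP cB].
have -> : #|[set i in B | i \notin initial s n]%SET| = #|B :\: initial s n|.
  by apply: eq_card => i; rewrite !inE andbC.
lia.
Qed.

(** * The two Ehrhart polynomials and their comparison *)

Definition pair_vec s m t
    (fg : {ffun 'I_s -> 'I_t.+1} * {ffun 'I_m -> 'I_t.+1}) : 'rV[int]_(s + m) :=
  row_mx (box_vec fg.1) (box_vec fg.2).

Lemma pair_vec_inj s m t : injective (@pair_vec s m t).
Proof. by move=> [f g] [f' g'] /eq_row_mx[/box_vec_inj /= -> /box_vec_inj /= ->]. Qed.

Lemma lattice_points_prod (R : realType) s m t (P : set 'rV[R]_s) (Q : set 'rV[R]_m) x y :
  lattice_points (dilate t (prod_polytope P Q)) (row_mx x y) <->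
  lattice_points (dilate t P) x /\ lattice_points (dilate t Q) y.
Proof.
rewrite /lattice_points /= map_row_mx; split.
  move=> [_ [u Pu [v Qv <-]]]; rewrite scale_row_mx => /eq_row_mx[<- <-].
  by split; [exists u|exists v].
move=> [[u Pu <-] [v Qv <-]]; exists (row_mx u v); last by rewrite scale_row_mx.
by exists u => //; exists v.
Qed.

Lemma is_ehrhart_prod (R : realType) a s q (p : {poly rat}) :
  (a <= s)%N ->
  (forall t, p.[t%:R] = (box_poly t ^+ s)`_(a * t) * 'C(t + q, q)%:R) ->
  is_ehrhart (prod_polytope (hypersimplex R a s) (hypersimplex R 1 q.+1)) p.
Proof.
move=> le_as hp t.
pose A := [set fg : {ffun 'I_s -> 'I_t.+1} * {ffun 'I_q.+1 -> 'I_t.+1} |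
      (\sum_i fg.1 i == a * t)%N && (\sum_i fg.2 i == t)%N]%SET.
exists #|A|; last by rewrite hp card_box_simplex_pair.
rewrite (_ : lattice_points _ = [set pair_vec fg | fg in [set fg | fg \in A]]).
  exact/card_eq_image_finset/pair_vec_inj.
apply/seteqP; split=> [z|_ [[f g] + <-]] /=.
  rewrite -[z]hsubmxK => /lattice_points_prod[hx hy].
  have [f fE] := @lattice_points_natvec R s (uniform_bases a s) t _ hx.
  have [g gE] := @lattice_points_natvec R q.+1 (uniform_bases 1 q.+1) t _ hy.
  exists (f, g); last by rewrite /pair_vec /= fE gE.
  move: hx hy; rewrite fE gE => /(lattice_points_hypersimplex _ _ le_as) sf.
  move=> /(@lattice_points_hypersimplex R 1 _ _ _ (ltn0Sn q)) sg.
  by rewrite inE /= sf sg mul1n !eqxx.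
rewrite /mkset inE /= => /andP[/eqP sf /eqP sg]; apply/lattice_points_prod; split.
  exact/lattice_points_hypersimplex.
by apply/lattice_points_hypersimplex; rewrite ?mul1n.
Qed.

Lemma is_ehrhart_panhandle (R : realType) r s q n (p : {poly rat}) :
  n = (s + q.+1)%N -> (0 < r)%N -> (r <= s)%N ->
  (forall t, p.[t%:R] = \sum_(j < t.+1) (box_poly t ^+ s)`_(r * t - j) *
     (box_poly t ^+ q.+1)`_j) ->
  is_ehrhart (indicator_hull R (panhandle_bases r s n)) p.
Proof.
move=> -> r0 rs hp t.
have sn : (s < s + q.+1)%N by lia.
pose A := [set fg : {ffun 'I_s -> 'I_t.+1} * {ffun 'I_q.+1 -> 'I_t.+1} |
      (\sum_i fg.1 i + \sum_i fg.2 i == r * t)%N && (\sum_i fg.2 i <= t)%N]%SET.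
exists #|A|.
  rewrite (_ : lattice_points _ = [set pair_vec fg | fg in [set fg | fg \in A]]).
    exact/card_eq_image_finset/pair_vec_inj.
  have key (f : {ffun 'I_(s + q.+1) -> 'I_t.+1}) (g : {ffun 'I_s -> 'I_t.+1})
      (h : {ffun 'I_q.+1 -> 'I_t.+1}) :
      (forall i, f (lshift _ i) = g i) -> (forall i, f (rshift _ i) = h i) ->
      (\sum_i f i = \sum_i g i + \sum_i h i)%N /\
      (\sum_(i | i \notin initial s (s + q.+1)) f i = \sum_i h i)%N.
    move=> fg fh; split.
      by rewrite big_split_ord /=; congr (_ + _)%N; apply: eq_bigr => i _; rewrite ?fg ?fh.
    rewrite big_split_ord /= big1 ?add0n => [|i].
      by apply: eq_big => i; [rewrite inE /= -leqNgt leq_addr|rewrite fh].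
    by rewrite inE /= ltn_ord.
  apply/seteqP; split=> [z hz|_ [[g h] + <-]] /=.
    have [f fE] := lattice_points_natvec hz; move: hz; rewrite fE.
    move=> /(lattice_points_panhandle _ _ r0 rs sn)[].
    pose g := [ffun i => f (lshift q.+1 i)]; pose h := [ffun i => f (rshift s i)].
    have [i|i|-> ->] := key f g h; [by rewrite ffunE|by rewrite ffunE|].
    move=> sf tf; exists (g, h); first by rewrite /mkset inE /= sf tf eqxx.
    apply/rowP => i; rewrite -(splitK i); case: (fintype.split i) => j /=.
      by rewrite row_mxEl /box_vec !mxE ffunE.
    by rewrite row_mxEr /box_vec !mxE ffunE.
  rewrite /mkset inE /= => /andP[/eqP sf tf].
  pose f := [ffun i => match fintype.split i with inl j => g j | inr j => h j end].
  have fl i : f (lshift _ i) = g i.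
    by rewrite ffunE -[lshift _ _]/(unsplit (inl i)) unsplitK.
  have fr i : f (rshift _ i) = h i.
    by rewrite ffunE -[rshift _ _]/(unsplit (inr i)) unsplitK.
  have [e1 e2] := key f g h fl fr.
  have -> : pair_vec (g, h) = box_vec f.
    apply/rowP => i; rewrite -(splitK i); case: (fintype.split i) => j /=.
      by rewrite row_mxEl /box_vec !mxE fl.
    by rewrite row_mxEr /box_vec !mxE fr.
  by apply/lattice_points_panhandle => //; rewrite e1 e2.
(* Since 0 < r, every j <= t satisfies the guard [j <= r * t]. *)
rewrite hp card_box_pair_sum; apply: eq_bigl => j.
by apply/esym; have := ltn_ord j; nia.
Qed.

Theorem mainTheorem4 (R : realType) (r s n : nat)
    (r_gt0 : (0 < r)%N) (le_rs : (r <= s)%N) (lt_sn : (s < n)%N) :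
  coef_le
    (ehrhart (prod_polytope (hypersimplex R (r - 1) s)
                            (hypersimplex R 1 (n - s))))
    (ehr_matroid R (panhandle le_rs lt_sn)).
Proof.
case: r r_gt0 le_rs => // r _ le_rs; rewrite subSS subn0.
have [q qE] : exists q, (n - s = q.+1)%N by exists (n - s).-1; lia.
have nE : n = (s + q.+1)%N by lia.
have [p p0 pE] := nneg_polyfunM (nneg_box_poly_diag (ltnW le_rs)) (nneg_polyfun_bin q).
have [d d0 dE] := nneg_box_poly_tail r s q.
have -> : ehrhart (prod_polytope (hypersimplex R r s) (hypersimplex R 1 (n - s))) = p.
  rewrite qE; apply/ehrhart_unique/is_ehrhart_prod; first exact: ltnW.
  by move=> t; rewrite -pE.
(* The rank is now [r.+1]. As (r + 1)t - t = rt, the summand j = t is the product count [p]; the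
   summands j < t form [d]. *)
have -> : ehr_matroid R (panhandle le_rs lt_sn) = d + p.
  apply: ehrhart_unique; apply: (@is_ehrhart_panhandle R r.+1 s q n (d + p) nE) => // t.
  rewrite hornerD -dE -pE big_ord_recr /= coef_box_poly_simplex//.
  rewrite mulSn addKn; congr (_ + _); apply: eq_bigr => j _.
  by rewrite mulrC coef_box_poly_simplex//; apply: ltnW.
by move=> k; rewrite coefD lerDr.
Qed.
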